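(* There is a function $\varepsilon:\mathbb{N}\to[0,1]$ with $\varepsilon(\tilde k)\to0$ as $\tilde k\to\infty$ such that the following holds. Let $G$ be an abelian group with $\tilde k$ elements and let $0<p<1$ be such that $p'=\min(p,1-p)$ satisfies $p'\ge 10^3(\log\tilde k)^{1/2}\tilde k^{-1/5}$. If $\Lambda\subseteq G\setminus\{0\}$ is chosen by the random procedure in the context, then with probability at least $1-\varepsilon(\tilde k)$ the Cayley graph $\widetilde H=\mathrm{Cayley}(G,\Lambda)$ is $(\frac{p'}{50},\frac{p'}{100})$-typical.
   Context: $\log$ is the natural logarithm. For an abelian group $G$ and $\Lambda\subseteq G\setminus\{0\}$ with $\Lambda=-\Lambda$, $\mathrm{Cayley}(G,\Lambda)$ has vertex set $G$, distinct $x,y$ adjacent iff $x-y\in\Lambda$. Random procedure: for each set $\{g,-g\}\subseteq G\setminus\{0\}$, include it in $\Lambda$ independently with probability $p$. The rotations of $\widetilde H=\mathrm{Cayley}(G,\Lambda)$ are the maps $G\to G$, $x\mapsto x+g$ ($g\in G$), and the reflections are the maps $x\mapsto -x+g$ ($g\in G$); together these are referred to as the $2\tilde k$ rotations and reflections. For distinct vertices $v,w$, $a_{\widetilde H}(v,w)=1$ if $v,w$ are adjacent and $0$ otherwise. For $0<q_0<\frac12$ and $0<\delta_0<1$, a Cayley graph $\widetilde H$ of an abelian group of order $\tilde k$ is $(q_0,\delta_0)$-typical if: (i) every vertex $v$ has degree $q_0\tilde k\le\deg(v)\le(1-q_0)\tilde k$; (ii) for any two distinct vertices $v,w$ there are at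 least $q_0\tilde k$ vertices in $V(\widetilde H)\setminus\{v,w\}$ adjacent to exactly one of $v,w$; (iii) there are no disjoint $X,Y\subseteq V(\widetilde H)$ with $|X|,|Y|\ge 2\tilde k^{4/5}$ such that $\widetilde H$ is complete or empty between $X$ and $Y$; (iv) for every $X\subseteq V(\widetilde H)$ with $|X|\ge(1-\delta_0)\tilde k$ and every injective $f:X\to V(\widetilde H)$ with $a_{\widetilde H}(v,w)=a_{\widetilde H}(f(v),f(w))$ for all distinct $v,w\in X$, there is a rotation or reflection $\phi$ of $\widetilde H$ with $f=\phi|_X$. *)

(* Defs.v *)
From HB Require Import structures.
From mathcomp Require Import all_boot all_order all_algebra.
From mathcomp Require Import all_classical all_reals all_analysis.

Set Implicit Arguments.
Unset Strict Implicit.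
Unset Printing Implicit Defensive.

Import Order.TTheory GRing.Theory Num.Theory.

Local Open Scope ring_scope.

Definition cayley (G : finZmodType) (Lambda : {set G}) : rel G :=
  fun x y => (x != y) && (x - y \in Lambda).

(* An inverse pair is a singleton when g has order two. *)
Definition inverse_pairs (G : finZmodType) : {set {set G}} :=
  [set [set g; - g] | g in [set~ (0 : G)]].

(* The outcomes are the sets S of chosen inverse pairs, under the product of
   Bernoulli(p) weights over all inverse pairs; the connection set is the
   union of the chosen pairs. *)
Definition connection_set_prob (R : realType) (G : finZmodType) (p : R)
    (E : {set G} -> Prop) : R :=
  \sum_(S in powerset (inverse_pairs G) | `[< E (finset.cover S) >])
    \prod_(A in inverse_pairs G) (if A \in S then p else 1 - p).

Definition rotation (G : finZmodType) (phi : G -> G) : Prop :=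
  exists g : G, forall x, phi x = x + g.

Definition reflection (G : finZmodType) (phi : G -> G) : Prop :=
  exists g : G, forall x, phi x = - x + g.

Definition neighbours (G : finZmodType) (H : rel G) (v : G) : {set G} :=
  [set w | H v w].

Definition distinguishers (G : finZmodType) (H : rel G) (v w : G) : {set G} :=
  [set u in ~: [set v; w] | H u v (+) H u w].

Definition complete_between (G : finZmodType) (H : rel G) (X Y : {set G}) :=
  forall x y, x \in X -> y \in Y -> H x y.

Definition empty_between (G : finZmodType) (H : rel G) (X Y : {set G}) :=
  forall x y, x \in X -> y \in Y -> ~~ H x y.

(* In the last clause a map defined on X is given by a total function on G of
   which only the restriction to X is used. *)
Definition typical (R : realType) (G : finZmodType) (q0 delta0 : R)
    (H : rel G) : Prop :=
  let k : R := #|G|%:R in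
  [/\ forall v : G, q0 * k <= #|neighbours H v|%:R <= (1 - q0) * k,
      forall v w : G, v != w -> q0 * k <= #|distinguishers H v w|%:R,
      ~ (exists X Y : {set G},
          [/\ [disjoint X & Y],
              2 * k `^ (4 / 5) <= #|X|%:R,
              2 * k `^ (4 / 5) <= #|Y|%:R &
              complete_between H X Y \/ empty_between H X Y]) &
      forall (X : {set G}) (f : G -> G),
        (1 - delta0) * k <= #|X|%:R ->
        {in X &, injective f} ->
        {in X &, forall v w, v != w -> H v w = H (f v) (f w)} ->
        exists phi : G -> G,
          (rotation phi \/ reflection phi) /\ {in X, f =1 phi}].

(* Main.v *)
(* Write p' = min(p, 1 - p). A partial isomorphism f forces, for all v, w, that
   v - w lies in Lambda iff f(v) - f(w) does; this is a real constraint unless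
   f(v) - f(w) = +-(v - w). If a positive proportion of the pairs in P x Q is
   constrained, where P is large and |Q| is at least a constant times s^3, then
   s points of P and s points of Q can be chosen greedily so that a constant
   times s^2 of the constraints involve pairwise distinct classes {g, -g}, hence
   are independent. Such a configuration survives with probability
   exp(-c p' s^2), and there are at most k^(4s) of them, so for s about k^(1/4)
   with high probability none survives. This rules out homogeneous pairs. For f defined
   on X it shows that f agrees with some x -> +-x + g on most of X, and then, with
   Q the graph of f on the exceptional set, that there are few exceptions. An
   exceptional vertex u and the preimage of f(u) under x -> +-x + g would have too
   few distinguishers. That all distinct v, w have at least p'k/25 distinguishers
   follows from the same independence, and it also gives the degree bounds. *)
Require Import Defs.
From HB Require Import structures.
From mathcomp Require Import all_boot all_order all_algebra.
From mathcomp Require Import zify ring lra.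

Set Implicit Arguments.
Unset Strict Implicit.
Unset Printing Implicit Defensive.

Import Order.TTheory GRing.Theory Num.Theory.

Local Open Scope ring_scope.

(** * Independent constraints *)

(** Greedy choice: keep one element and discard its at most [D] related elements, among them itself
    by reflexivity. *)
Lemma independent_subset (T : finType) (D : nat) (r : rel T) (A : {set T}) :
  symmetric r -> reflexive r ->
  (forall x, x \in A -> (#|[set y in A | r x y]| <= D)%N) ->
  exists2 B : {set T}, B \subset A &
    (#|A| <= D * #|B|)%N /\ {in B &, forall x y, x != y -> ~~ r x y}.
Proof.
move=> rsym rrefl; elim: {A}#|A| {-2}A (leqnn #|A|) => [|n IHn] A.
  rewrite leqn0 cards_eq0 => /eqP -> _; exists set0; first exact: sub0set.
  by split=> [|x y]; rewrite ?cards0 // inE.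
move=> leAn degA; have [->|[x xA]] := set_0Vmem A.
  exists set0; first exact: sub0set.
  by split=> [|y z]; rewrite ?cards0 // inE.
pose A' := A :\: [set y in A | r x y].
have sA'A : A' \subset A by exact: subsetDl.
have cA : (#|A| <= D + #|A'|)%N.
  by rewrite -(cardsID [set y in A | r x y] A) leq_add2r
    (leq_trans _ (degA x xA)) // subset_leq_card // subsetIr.
have ltA' : (#|A'| < #|A|)%N.
  apply: proper_card; rewrite properE sA'A /=.
  by apply/subsetPn; exists x => //; rewrite !inE xA rrefl.
have [|y /(subsetP sA'A) yA|B sBA' [cB indB]] := IHn A'.
- by rewrite -ltnS (leq_trans ltA').
- apply: leq_trans (degA y yA); apply: subset_leq_card.
  by apply/subsetP => z; rewrite !inE => /andP[/andP[_ ->] ->].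
have nrx y : y \in B -> ~~ r x y.
  by move=> /(subsetP sBA'); rewrite !inE => /andP[/nandP[/negPf->|//]].
have xB : x \notin B by apply/negP => /nrx; rewrite rrefl.
exists (x |: B); first by rewrite subUset sub1set xA (subset_trans sBA').
split; first by rewrite cardsU1 xB mulnDr muln1 (leq_trans cA) // leq_add2l.
move=> y z; rewrite !inE => /predU1P[->|yB] /predU1P[->|zB] yz.
- by rewrite eqxx in yz.
- exact: nrx.
- by rewrite rsym nrx.
- exact: indB.
Qed.

(** Averaging: light points contribute at most half of the required total, so the heavy ones, at
    most [#|Q|] each, supply the rest. *)
Lemma heavy_points (T U : finType) (c : nat) (r : T -> U -> bool)
    (P : {set T}) (Q : {set U}) :
  (0 < #|Q|)%N ->
  (#|P| * #|Q| <= c * \sum_(p in P) #|[set q in Q | r p q]|)%N ->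
  (#|P| <= 2 * c * #|[set p in P |
      #|Q| <= 2 * c * #|[set q in Q | r p q]|]|)%N.
Proof.
move=> Q0 dens; set V := [set p in P | _].
have sVP : V \subset P by apply/subsetP => p; rewrite inE => /andP[].
suff : (2 * c * \sum_(p in P) #|[set q in Q | r p q]| <=
        2 * c * #|V| * #|Q| + #|P| * #|Q|)%N by nia.
rewrite (big_setID V) /= (setIidPr sVP) mulnDr leq_add //.
  rewrite -[leqRHS]mulnA leq_mul2l -sum_nat_const leq_sum ?orbT // => p _.
  by rewrite subset_leq_card //; apply/subsetP => q; rewrite inE => /andP[].
rewrite big_distrr /= (@leq_trans (\sum_(p in P :\: V) #|Q|)%N) //.
  apply: leq_sum => p; rewrite !inE => /andP[].
  by rewrite negb_and => /orP[/negPf->//|]; rewrite -ltnNge => /ltnW.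
by rewrite sum_nat_const leq_mul2r subset_leq_card ?orbT ?subsetDl.
Qed.

Lemma subset_card_eq (T : finType) (A : {set T}) (n : nat) :
  (n <= #|A|)%N -> exists2 B : {set T}, B \subset A & #|B| = n.
Proof.
move=> /card_geqP[s [us ss sA]]; exists [set x in s].
  by apply/subsetP => x; rewrite inE => /sA.
by rewrite cardsE (card_uniqP us).
Qed.

Lemma card_setId_sum (T : finType) (A : {set T}) (r : pred T) :
  #|[set x in A | r x]| = (\sum_(x in A) r x)%N.
Proof.
rewrite -sum1_card (eq_bigl (fun x => (x \in A) && r x)); last first.
  by move=> x; rewrite inE.
by rewrite big_mkcondr; apply: eq_bigr => x _; case: (r x).
Qed.

Lemma leq_card_bigcup (I T : finType) (A : {set I}) (F : I -> {set T}) (m : nat) :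
  (forall i, i \in A -> #|F i| <= m)%N ->
  (#|\bigcup_(i in A) F i| <= #|A| * m)%N.
Proof.
move=> Fm; rewrite -sum_nat_const.
elim/big_rec2: _ => [|i n B iA IH]; first by rewrite cards0.
by rewrite (leq_trans (leq_card_setU _ _)) // leq_add // Fm.
Qed.

(** * Conflict-free families of constraints *)

Section Matchings.
Variable G : finZmodType.
Implicit Types (g h : G) (p q : G * G) (e : (G * G) * (G * G)).

(** Equality of the inverse pairs of [g] and [h], hence of the random choices that decide their
    membership in the connection set. *)
Definition sim g h := (g == h) || (g == - h).

Lemma sim_sym : symmetric sim.
Proof. by move=> g h; rewrite /sim eq_sym; congr orb; rewrite eq_sym eqr_oppLR. Qed.

Lemma sim_trans : transitive sim.
Proof.
move=> y x z /orP[/eqP->//|/eqP->] /orP[/eqP->|/eqP->];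
by rewrite /sim ?opprK eqxx ?orbT.
Qed.

(* A point [(v, v')] stands for [f v = v']. The pair of points [e] carries the
   constraint [lsrc e \in Lambda <-> ldst e \in Lambda], which is nontrivial
   exactly when [bad e.1 e.2]. *)
Definition lsrc e := e.1.1 - e.2.1.
Definition ldst e := e.1.2 - e.2.2.

Definition bad p q :=
  [&& p.1 != q.1, p.2 != q.2 & ~~ sim (p.1 - q.1) (p.2 - q.2)].

Definition conflict e e' :=
  [|| sim (lsrc e) (lsrc e'), sim (lsrc e) (ldst e'),
      sim (ldst e) (lsrc e') | sim (ldst e) (ldst e')].

(** Each constraint involves two distinct inverse pairs, and different constraints share none, so
    they are independent events. *)
Definition matching (M : {set (G * G) * (G * G)}) :=
  (forall e, e \in M -> bad e.1 e.2) /\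
  {in M &, forall e e', e != e' -> ~~ conflict e e'}.

Definition partial_inj (P : {set G * G}) :=
  {in P &, injective fst} /\ {in P &, injective snd}.

Lemma partial_injS (P Q : {set G * G}) :
  P \subset Q -> partial_inj Q -> partial_inj P.
Proof.
by move=> /subsetP PQ [i1 i2]; split=> x y xP yP; [apply: i1|apply: i2];
  apply: PQ.
Qed.

Lemma conflict_refl : reflexive conflict.
Proof. by move=> e; rewrite /conflict /sim eqxx. Qed.

Lemma conflict_sym : symmetric conflict.
Proof.
move=> e e'; rewrite /conflict !(sim_sym (lsrc e')) !(sim_sym (ldst e')).
by congr orb; rewrite orbCA.
Qed.

Lemma card_sim_le2 (T : finType) (A : {set T}) (F : T -> G) g :
  {in A &, injective F} -> (#|[set x in A | sim g (F x)]| <= 2)%N.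
Proof.
move=> Finj; have -> : #|[set x in A | sim g (F x)]| =
    #|F @: [set x in A | sim g (F x)]|.
  by rewrite card_in_imset // => x y; rewrite !inE => /andP[xA _] /andP[yA _];
    exact: Finj.
apply: (@leq_trans #|[set g; - g]|); last by rewrite cards2; case: eqP.
apply/subset_leq_card/subsetP => h /imsetP[x]; rewrite inE => /andP[_].
by rewrite /sim !inE => /orP[/eqP<-|/eqP->] ->; rewrite ?opprK eqxx ?orbT.
Qed.

(** A conflict is one of four [sim] conditions, each met by at most two [x]. *)
Lemma card_conflict_le8 (T : finType) (A : {set T})
    (F : T -> (G * G) * (G * G)) e :
  {in A &, injective (lsrc \o F)} -> {in A &, injective (ldst \o F)} ->
  (#|[set x in A | conflict e (F x)]| <= 8)%N.
Proof.
move=> inj1 inj2.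
have -> : [set x in A | conflict e (F x)] =
    [set x in A | sim (lsrc e) ((lsrc \o F) x)] :|:
    [set x in A | sim (lsrc e) ((ldst \o F) x)] :|:
    [set x in A | sim (ldst e) ((lsrc \o F) x)] :|:
    [set x in A | sim (ldst e) ((ldst \o F) x)].
  by apply/setP => x; rewrite !inE /conflict /=; case: (x \in A);
    rewrite //= !orbA.
apply: leq_trans (leq_card_setU _ _) (@leq_add _ _ 6 2 _ (card_sim_le2 _ inj2)).
apply: leq_trans (leq_card_setU _ _) (@leq_add _ _ 4 2 _ (card_sim_le2 _ inj1)).
apply: leq_trans (leq_card_setU _ _) (@leq_add _ _ 2 2 _ (card_sim_le2 _ inj2)).
exact: card_sim_le2.
Qed.

(** With [q] fixed, either difference determines [p], so a constraint through [q] conflicts with at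
    most eight others, itself included. *)
Lemma star_matching (S : {set G * G}) q :
  partial_inj S ->
  exists M : {set G * G},
    [/\ forall p, p \in M -> (p \in S) && bad p q,
        (#|[set p in S | bad p q]| <= 8 * #|M|)%N &
        {in M &, forall p p', p != p' -> ~~ conflict (p, q) (p', q)}].
Proof.
move=> [inj1 inj2].
have [||p|M sM [cM iM]] := @independent_subset _ 8
  (fun p p' => conflict (p, q) (p', q)) [set p in S | bad p q].
- by move=> p p'; exact: conflict_sym.
- by move=> p; exact: conflict_refl.
- move=> _; apply: card_conflict_le8 => p1 p2; rewrite !inE => /andP[p1S _]
    /andP[p2S _] /addIr; [exact: inj1|exact: inj2].
by exists M; split=> // p /(subsetP sM); rewrite inE.
Qed.

(* The constant is 2 * 200 * 8: two rounds of [heavy_points] starting from density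
   1/100, and [card_conflict_le8]. *)
Lemma dense_matching (s : nat) (P Q : {set G * G}) :
  partial_inj P -> partial_inj Q ->
  (0 < s)%N -> (200 * s <= #|P|)%N -> (3200 * s ^ 3 <= #|Q|)%N ->
  (#|P| * #|Q| <= 100 * \sum_(p in P) #|[set q in Q | bad p q]|)%N ->
  exists S1 S2 : {set G * G},
    [/\ S1 \subset P, S2 \subset Q, #|S1| = s, #|S2| = s &
    exists M : {set (G * G) * (G * G)},
      [/\ forall e, e \in M -> (e.1 \in S1) && (e.2 \in S2),
          matching M & (s ^ 2 <= 3200 * #|M|)%N]].
Proof.
move=> injP injQ s0 leP leQ dens.
have Q0 : (0 < #|Q|)%N by apply: leq_trans leQ; rewrite muln_gt0 expn_gt0 s0.
have /= := heavy_points Q0 dens; set V := [set p in P | _] => leV.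
have [|S1 sS1V cS1] := @subset_card_eq _ V s.
  by rewrite -(@leq_pmul2l 200) // (leq_trans leP).
have sS1P : S1 \subset P.
  by apply: subset_trans sS1V _; apply/subsetP => p; rewrite inE => /andP[].
have injS1 := partial_injS sS1P injP.
(* Second averaging, with roles exchanged: points of [Q] bad with at least 1/400 of [S1]. *)
pose W := [set q in Q | (#|S1| <= 2 * 200 * #|[set p in S1 | bad p q]|)%N].
have leW : (#|Q| <= 2 * 200 * #|W|)%N.
  apply: (@heavy_points _ _ 200 (fun q p => bad p q)); first by rewrite cS1.
  have -> : (\sum_(q in Q) #|[set p in S1 | bad p q]| =
      \sum_(p in S1) #|[set q in Q | bad p q]|)%N.
    under eq_bigr do rewrite card_setId_sum.
    under [RHS]eq_bigr do rewrite card_setId_sum.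
    exact: exchange_big.
  rewrite mulnC -sum_nat_const big_distrr /=; apply: leq_sum => p.
  by move=> /(subsetP sS1V); rewrite inE => /andP[].
(* Stars from [S1] to unrelated [q], [q'] share no inverse pair. The bound [8 * s ^ 2] has one
   factor [s] for each of [p] and [p']. *)
pose r q q' := [exists p in S1, exists p' in S1, conflict (p, q) (p', q')].
have sWQ : W \subset Q by apply/subsetP => q; rewrite inE => /andP[].
have [||q qW|B sBW [cB iB]] := @independent_subset _ (8 * s ^ 2) r W.
- move=> q q'; apply/idP/idP => /exists_inP[p pS /exists_inP[p' p'S c]];
  by apply/exists_inP; exists p' => //; apply/exists_inP; exists p => //;
    rewrite conflict_sym.
- move=> q; have /card_gt0P[p pS] : (0 < #|S1|)%N by rewrite cS1.
  by apply/exists_inP; exists p => //; apply/exists_inP; exists p => //;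
    exact: conflict_refl.
- have -> : [set q' in W | r q q'] = \bigcup_(p in S1) \bigcup_(p' in S1)
      [set q' in W | conflict (p, q) (p', q')].
    apply/setP => q'; apply/idP/bigcupP.
      rewrite inE => /andP[q'W /exists_inP[p pS /exists_inP[p' p'S c]]].
      by exists p => //; apply/bigcupP; exists p' => //; rewrite inE q'W.
    move=> [p pS /bigcupP[p' p'S]]; rewrite !inE => /andP[-> c] /=.
    by apply/exists_inP; exists p => //; apply/exists_inP; exists p'.
  have le8 p p' : (#|[set q' in W | conflict (p, q) (p', q')]| <= 8)%N.
    have [i1 i2] := partial_injS sWQ injQ.
    by apply: card_conflict_le8 => q1 q2 q1W q2W /= /addrI/oppr_inj;
      [exact: i1|exact: i2].
  rewrite mulnC -mulnn -mulnA -{1}cS1; apply: leq_card_bigcup => p _.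
  by rewrite -cS1; apply: leq_card_bigcup => p' _; exact: le8.
(* Here [3200 * s ^ 3 <= #|Q| <= 400 * #|W| <= 3200 * s ^ 2 * #|B|]. *)
have [S2 sS2B cS2] : exists2 S2 : {set G * G}, S2 \subset B & #|S2| = s.
  apply: subset_card_eq; rewrite -(@leq_pmul2l (3200 * s ^ 2)); last first.
    by rewrite muln_gt0 expn_gt0 s0.
  rewrite -mulnA -expnSr (leq_trans leQ) // (leq_trans leW) //.
  by move: #|W| #|B| (s ^ 2)%N cB; clear => w b t; nia.
have sS2W := subset_trans sS2B sBW.
have /fin_all_exists[MM MMP] := fun q => star_matching q injS1.
exists S1, S2; split=> //; first exact: subset_trans sS2W sWQ.
pose M := [set e | (e.2 \in S2) && (e.1 \in MM e.2)].
have sM e : e \in M -> [/\ e.2 \in S2, e.1 \in MM e.2, e.1 \in S1 & bad e.1 e.2].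
  rewrite inE => /andP[eS eM]; have [/(_ _ eM)/andP[]] := MMP e.2.
  by [].
exists M; split.
- by move=> e /sM[-> _ -> _].
- split; first by move=> e /sM[].
  move=> [p q] [p' q'] /sM[/= qS pM pS _] /sM[/= q'S p'M p'S _].
  case: (eqVneq q q') => [qq'|qq' _].
    move: p'M; rewrite -qq' xpair_eqE eqxx andbT => p'M.
    by have [_ _ iM] := MMP q; exact: iM.
  have /exists_inPn/(_ _ pS)/exists_inPn/(_ _ p'S) := iB _ _ (subsetP sS2B _ qS)
    (subsetP sS2B _ q'S) qq'.
  by [].
- have -> : #|M| = (\sum_(q in S2) #|MM q|)%N.
    under eq_bigr do rewrite -sum1_card.
    rewrite pair_big_dep -sum1_card /= (reindex (fun e => (e.2, e.1))) /=.
      by apply: eq_bigl => -[p q]; rewrite inE.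
    by exists (fun e => (e.2, e.1)) => -[].
  rewrite -mulnn -{1}cS2 -sum_nat_const big_distrr /=; apply: leq_sum => q.
  move=> /(subsetP sS2W); rewrite inE cS1 => /andP[_].
  have [_ + _] := MMP q.
  by move: #|MM q| #|_| => a b; clear; lia.
Qed.

End Matchings.

(** * Rigidity implies typicality *)

Section Rigidity.
Variable G : finZmodType.
Implicit Types (g h v w : G) (p q : G * G) (Lambda X Y : {set G}).

Definition respects Lambda (e : (G * G) * (G * G)) :=
  (lsrc e \in Lambda) == (ldst e \in Lambda).

Definition testing (s : nat) (S1 S2 : {set G * G}) :=
  exists M : {set (G * G) * (G * G)},
    [/\ forall e, e \in M -> (e.1 \in S1) && (e.2 \in S2),
        matching M & (s ^ 2 <= 3200 * #|M|)%N].

Definition respected Lambda (P Q : {set G * G}) :=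
  forall p q, p \in P -> q \in Q -> bad p q -> respects Lambda (p, q).

(* The pairs [(S1, S2)] range over at most [#|G| ^ (4 * s)] possibilities, whereas
   each is respected with probability exponentially small in [s ^ 2]. *)
Definition rigid (s : nat) Lambda :=
  forall S1 S2 : {set G * G}, #|S1| = s -> #|S2| = s ->
    testing s S1 S2 -> ~ respected Lambda S1 S2.

(** Otherwise [dense_matching] would extract a testing pair that inherits the respected
    constraints. *)
Lemma rigid_dense (s : nat) Lambda (P Q : {set G * G}) :
  rigid s Lambda -> partial_inj P -> partial_inj Q ->
  (0 < s)%N -> (200 * s <= #|P|)%N -> (3200 * s ^ 3 <= #|Q|)%N ->
  (forall q, q \in Q -> #|P| <= 100 * #|[set p in P | bad p q]|)%N ->
  ~ respected Lambda P Q.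
Proof.
move=> rig injP injQ s0 leP leQ dens resp.
have [|S1 [S2 [sP sQ c1 c2 M]]] := dense_matching injP injQ s0 leP leQ.
  have -> : (\sum_(p in P) #|[set q in Q | bad p q]| =
      \sum_(q in Q) #|[set p in P | bad p q]|)%N.
    under eq_bigr do rewrite card_setId_sum.
    under [RHS]eq_bigr do rewrite card_setId_sum.
    exact: exchange_big.
  by rewrite mulnC -sum_nat_const big_distrr /=; apply: leq_sum.
apply: (rig S1 S2 c1 c2 M) => p q pS qS.
by apply: resp; [exact: (subsetP sP)|exact: (subsetP sQ)].
Qed.

(* A homogeneous pair [(X, Y)] is treated as a partial isomorphism acting on [X]
   by such a shift and on [Y] by the identity. *)
Lemma cyclic_shift (T : finType) (X : {set T}) : (3 <= #|X|)%N ->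
  exists f : T -> T, [/\ forall x, x \in X -> f x \in X,
    injective f & forall x, x \in X -> f x != x /\ f (f x) != x].
Proof.
move=> X3; exists (next (enum X)); split.
- by move=> x; rewrite -!(mem_enum X) mem_next.
- exact/can_inj/prev_next/enum_uniq.
move=> x; rewrite -mem_enum => xX.
(* Rotated to start at [x], the enumeration begins with [x], [f x], [f (f x)]. *)
have [i s' def] := rot_to xX.
have := size_rot i (enum X); have := rot_uniq i (enum X).
rewrite -!(next_rot i (enum_uniq _)) -cardE def enum_uniq.
case: s' {def} => [|y [|z s]] /= => [_ c|_ c|]; try by rewrite -c in X3.
rewrite !inE !negb_or eqxx => /and3P[/and3P[xy xz _] /andP[yz _] _] _.
by case: (eqVneq y x) xy => [->|yx _]; rewrite eqxx // eq_sym.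
Qed.

Lemma no_homogeneous_pair (s : nat) Lambda X Y :
  rigid s Lambda -> [disjoint X & Y] ->
  (0 < s)%N -> (3 + 200 * s <= #|X|)%N -> (3200 * s ^ 3 <= #|Y|)%N ->
  ~ (complete_between (cayley Lambda) X Y \/ empty_between (cayley Lambda) X Y).
Proof.
move=> rig dXY s0 leX leY homog.
have [|f [fX finj fne]] := @cyclic_shift _ X; first by lia.
pose P := [set (x, f x) | x in X]; pose Q := [set (y, y) | y in Y].
have XY x y : x \in X -> y \in Y -> x != y.
  by move=> xX yY; apply: contraTneq yY => <-; rewrite (disjointFr dXY).
have cP : #|P| = #|X| by rewrite card_imset // => x y [].
have cQ : #|Q| = #|Y| by rewrite card_imset // => x y [].
have H x y : x \in X -> y \in Y -> cayley Lambda x y = (x - y \in Lambda).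
  by move=> xX yY; rewrite /cayley XY.
have pP : partial_inj P.
  by split=> _ _ /imsetP[x xX ->] /imsetP[y yY ->] /= => [->|/finj->].
have pQ : partial_inj Q.
  by split=> _ _ /imsetP[x xX ->] /imsetP[y yY ->] /= ->.
apply: (@rigid_dense s Lambda P Q) => //; rewrite ?cP ?cQ //; last first.
- move=> _ _ /imsetP[x xX ->] /imsetP[y yY ->] _; rewrite /respects /lsrc /ldst /=.
  case: homog => h; rewrite -!H ?fX //.
    by rewrite !h ?fX.
  by rewrite !(negPf (h _ _ _ _)) ?fX.
- move=> _ /imsetP[y yY ->].
  pose F := [set x in X | x + f x == y + y].
  have sF : (#|F| + #|F| <= #|X|)%N.
    rewrite -{1}(card_imset (mem F) finj) -cardsUI.
    have -> : (f @: F) :&: F = set0.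
      apply/setP => z; rewrite !inE; apply/negP => /andP[/imsetP[x + ->]].
      rewrite inE => /andP[xX /eqP xy] /andP[_ /eqP].
      rewrite -xy addrC => /addIr /eqP; rewrite (negPf (fne x xX).2) //.
    rewrite cards0 addn0 subset_leq_card // subUset; apply/andP; split.
      by apply/subsetP => _ /imsetP[x + ->]; rewrite inE => /andP[/fX].
    by apply/subsetP => x; rewrite inE => /andP[].
  have sB : [set (x, f x) | x in X :\: F] \subset [set p in P | bad p (y, y)].
    apply/subsetP => _ /imsetP[x + ->]; rewrite !inE => /andP[+ xX].
    rewrite xX /= => nF; rewrite imset_f //= /bad /= !XY ?fX //=.
    apply: contra nF => /orP[/eqP/addIr/esym/eqP|/eqP].
      by rewrite (negPf (fne x xX).1).
    by rewrite opprB => /eqP; rewrite subr_eq addrAC eq_sym subr_eq addrC => /eqP->.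
  have := subset_leq_card sB; rewrite card_imset; last by move=> ? ? [].
  have sFX : F \subset X by apply/subsetP => x; rewrite inE => /andP[].
  have := cardsID F X; rewrite (setIidPr sFX).
  by move: sF; move: #|_| #|_| #|_| #|_| => a b c d; clear; lia.
- by lia.
Qed.

(** The solutions are empty or a coset of the 2-torsion. If all of [G] were 2-torsion, a solution
    would force [g + h = 0], so [g = h]; otherwise translation by [d] with [d + d != 0] gives a
    disjoint copy. *)
Lemma card_double_le g h : g != h ->
  (2 * #|[set a : G | (a + a == g + h)%R]| <= #|G|)%N.
Proof.
move=> gh; set T := [set a : G | _].
have [->|[t tT]] := set_0Vmem T; first by rewrite cards0.
have [d dd] : exists d : G, d + d != 0.
  apply/existsP; apply: contraNT gh; rewrite negb_exists => /forallP tor.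
  move: tT; rewrite inE; have := tor t; rewrite negbK => /eqP->.
  have := tor g; rewrite negbK addr_eq0 => /eqP gg.
  by rewrite eq_sym addrC addr_eq0 -gg eq_sym.
have dinj : injective (fun x => x + d) by exact: addIr.
rewrite mul2n -addnn -{1}(card_imset (mem T) dinj) -cardsUI.
have -> : [set x + d | x in T] :&: T = set0.
  apply/setP => z; rewrite !inE; apply/negP => /andP[/imsetP[x + ->]].
  rewrite inE addrACA => /eqP-> /eqP/(canRL (addKr _)).
  by rewrite addNr => /eqP; rewrite (negPf dd).
by rewrite cards0 addn0 max_card.
Qed.

Lemma sim_double v u u' :
  u != u' -> sim (v - u) (v - u') = (v + v == u + u').
Proof.
move=> uu'; rewrite /sim (inj_eq (addrI v)) eqr_opp (negPf uu') /= opprB.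
by rewrite subr_eq addrAC eq_sym subr_eq eq_sym [u' + u]addrC.
Qed.

(** The constraint between [(u, u)] and [(v, w)] says that [u] does not distinguish [v] and [w]. At
    most [2 + #|G| / 2] diagonal points are not bad with [(v, w)]. *)
Lemma distinguishing_matching v w : v != w ->
  exists M : {set (G * G) * (G * G)}, [/\ matching M, (#|G| <= 16 * #|M| + 4)%N &
    forall Lambda, (#|[set e in M | ~~ respects Lambda e]| <=
      #|distinguishers (cayley Lambda) v w|)%N].
Proof.
move=> vw; pose S := [set (u, u) | u in [set: G]].
have injS : partial_inj S.
  by split=> _ _ /imsetP[u _ ->] /imsetP[u' _ ->] /= ->.
have [M0 [M0S cM0 iM0]] := star_matching (v, w) injS.
have inj_q : injective (fun p : G * G => (p, (v, w))) by move=> p p' [].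
exists [set (p, (v, w)) | p in M0]; split.
- split=> [_ /imsetP[p pM ->]|_ _ /imsetP[p pM ->] /imsetP[p' p'M ->]].
    by have /andP[] := M0S p pM.
  by rewrite (inj_eq inj_q) => /(iM0 _ _ pM p'M).
- rewrite card_imset //; have := card_double_le vw.
  set T := [set a : G | _] => leT.
  have cG : (#|G| <= 2 + #|T| + #|[set p in S | bad p (v, w)]|)%N.
    have -> : #|[set p in S | bad p (v, w)]| = #|~: ([set v; w] :|: T)|.
      have inj_diag : injective (fun u : G => (u, u)) by move=> ? ? [].
      rewrite -[RHS](card_imset _ inj_diag).
      apply: eq_card => p; rewrite inE; apply/andP/imsetP.
        move=> [/imsetP[u _ ->] /and3P[/= uv uw ns]]; exists u => //.
        by rewrite !inE (negPf uv) (negPf uw) -sim_double.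
      move=> [u + ->]; rewrite !inE !negb_or => /andP[/andP[uv uw] nd].
      by rewrite imset_f // /bad /= uv uw sim_double.
    rewrite -(cardsC ([set v; w] :|: T)) leq_add2r.
    by rewrite (leq_trans (leq_card_setU _ _)) // leq_add2r cards2 vw.
  have ar (a b c d : nat) : (2 * b <= a -> a <= 2 + b + c -> c <= 8 * d ->
    a <= 16 * d + 4)%N by clear; lia.
  exact: ar leT cG cM0.
- move=> Lambda.
  apply: leq_trans (leq_imset_card (fun u => ((u, u), (v, w)))
    (mem (distinguishers (cayley Lambda) v w))).
  apply/subset_leq_card/subsetP => e; rewrite inE => /andP[/imsetP[p pM ->]].
  have /andP[/imsetP[u _ ->] /and3P[/= uv uw _]] := M0S p pM.
  rewrite /respects /lsrc /ldst /= => nresp; apply: imset_f.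
  by rewrite !inE /cayley negb_or uv uw /=; case: (_ \in _) (_ \in _) nresp => [] [].
Qed.

Section FixedLambda.
Variable Lambda : {set G}.
Hypothesis symL : forall g, (- g \in Lambda) = (g \in Lambda).

Lemma sim_mem g h : sim g h -> (g \in Lambda) = (h \in Lambda).
Proof. by case/orP => /eqP ->. Qed.

Lemma cayley_sym : symmetric (cayley Lambda).
Proof. by move=> v w; rewrite /cayley eq_sym -symL opprB. Qed.

Lemma card_neighbours v w :
  #|neighbours (cayley Lambda) v| = #|neighbours (cayley Lambda) w|.
Proof.
rewrite -(card_imset (mem (neighbours (cayley Lambda) v)) (addIr (w - v))).
apply: eq_card => x; rewrite -(subrK (w - v) x) (mem_imset _ _ (addIr _)).
rewrite !inE /cayley; set y := x - _.
have e : w - (y + (w - v)) = v - y.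
  by rewrite addrCA opprD addNKr opprB.
by rewrite e -(subr_eq0 v) -(subr_eq0 w) e.
Qed.

(** A distinguisher lies in one of two neighbourhoods of equal size. This and the complementary
    bound turn spreading into degree bounds. *)
Lemma distinguishers_neighbours v w :
  (#|distinguishers (cayley Lambda) v w| <=
     2 * #|neighbours (cayley Lambda) v|)%N.
Proof.
rewrite mul2n -addnn {2}(card_neighbours v w).
apply: leq_trans (leq_card_setU _ _); apply/subset_leq_card/subsetP => u.
rewrite !inE ![cayley _ u _]cayley_sym => /andP[_].
by case: (cayley _ v u); case: (cayley _ w u).
Qed.

Lemma distinguishers_nonneighbours v w :
  (#|distinguishers (cayley Lambda) v w| <=
     2 * (#|G| - #|neighbours (cayley Lambda) v|))%N.
Proof.
have card_nonnbr x : (#|G| - #|neighbours (cayley Lambda) x| =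
    #|~: neighbours (cayley Lambda) x|)%N.
  by rewrite -(cardsC (neighbours (cayley Lambda) x)) addKn.
rewrite mul2n -addnn {2}(card_neighbours v w) !card_nonnbr.
apply: leq_trans (leq_card_setU _ _); apply/subset_leq_card/subsetP => u.
rewrite !inE ![cayley _ u _]cayley_sym => /andP[_].
by case: (cayley _ v u); case: (cayley _ w u).
Qed.

(** * Partial isomorphisms of a rigid Cayley graph *)

Section PartialIsomorphism.
Variables (s : nat) (X : {set G}) (f : G -> G).
Hypotheses (rig : rigid s Lambda) (s0 : (0 < s)%N).
Hypotheses (leGX : (199 * #|G| <= 200 * #|X|)%N).
Hypothesis leX : (10 * (3200 * s ^ 3) <= #|X|)%N.
Hypothesis spread : forall v w, v != w ->
  (#|~: X| + 3200 * s ^ 3 <= #|distinguishers (cayley Lambda) v w|)%N.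
Hypothesis finj : {in X &, injective f}.
Hypothesis fiso : {in X &, forall v w, v != w ->
  cayley Lambda v w = cayley Lambda (f v) (f w)}.

Definition graph (Y : {set G}) := [set (x, f x) | x in Y].

Lemma card_graph (Y : {set G}) : #|graph Y| = #|Y|.
Proof. by rewrite card_imset // => x y []. Qed.

Lemma graph_inj (Y : {set G}) : Y \subset X -> partial_inj (graph Y).
Proof.
move=> /subsetP YX.
by split=> _ _ /imsetP[x xX ->] /imsetP[y yY ->] /= => [->|/finj->]; auto.
Qed.

Lemma graph_respected (Y Z : {set G}) : Y \subset X -> Z \subset X ->
  respected Lambda (graph Y) (graph Z).
Proof.
move=> /subsetP YX /subsetP ZX _ _ /imsetP[x xY ->] /imsetP[z zZ ->].
rewrite /bad /respects /lsrc /ldst /= => /and3P[xz fxz _].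
have := fiso (YX _ xY) (ZX _ zZ) xz.
by rewrite /cayley xz fxz /= => ->.
Qed.

Lemma bad_graph x y : x \in X -> y \in X ->
  bad (x, f x) (y, f y) = ~~ sim (x - y) (f x - f y).
Proof.
move=> xX yX; rewrite /bad /=; case: eqVneq => [->|xy] /=.
  by rewrite !subrr /sim eqxx.
by case: eqP => //= /finj e; rewrite e ?eqxx // in xy.
Qed.

Lemma s_le_cube : (s <= s ^ 3)%N.
Proof. by rewrite -{1}[s]expn1 leq_pexp2l. Qed.

(** [phi] stands for a rotation or reflection. Rigidity makes the exceptional set small; an
    exceptional [u] and [psi (f u)] look alike from every vertex of agreement, so they have too few
    distinguishers for [spread]. *)
Lemma agree_everywhere (phi psi : G -> G) :
  cancel phi psi -> cancel psi phi ->
  (forall x y, sim (x - y) (phi x - phi y)) ->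
  (87 * #|G| <= 100 * #|[set x in X | f x == phi x]|)%N ->
  {in X, f =1 phi}.
Proof.
move=> phiK psiK phi_sim; set A := [set x in X | _] => leA.
have sAX : A \subset X by apply/subsetP => x; rewrite inE => /andP[].
have ne_psi u : u \in X :\: A -> u != psi (f u).
  rewrite !inE => /andP[/nandP[/negPf->//|+ uX]].
  by apply: contra => /eqP {2}->; rewrite psiK.
have simA a u : a \in A -> u \in X :\: A ->
    sim (a - u) (f a - f u) = (a + a == u + psi (f u)).
  rewrite inE => /andP[_ /eqP-> uU]; rewrite -{1}(psiK (f u)).
  rewrite -sim_double ?ne_psi //; apply/idP/idP => h.
    by apply: sim_trans h _; rewrite sim_sym.
  by apply: sim_trans h _.
(* For an exceptional [u], all but the at most [#|G| / 2] solutions [a] of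
   [a + a = u + psi (f u)] are bad. *)
have ltU : (#|X :\: A| < 3200 * s ^ 3)%N.
  rewrite ltnNge; apply/negP => leU.
  apply: (@rigid_dense s Lambda (graph A) (graph (X :\: A))) => //.
  - exact: graph_inj.
  - exact/graph_inj/subsetDl.
  - have cX : (#|X| <= #|G|)%N := max_card _.
    rewrite card_graph; move: leX s_le_cube cX leA.
    by move: #|X| #|G| #|A| (s ^ 3)%N => a b c d; clear; lia.
  - by rewrite card_graph.
  - move=> _ /imsetP[u uU ->]; rewrite card_graph.
    have uX : u \in X by move: uU; rewrite inE => /andP[].
    have := card_double_le (ne_psi u uU); set T := [set a : G | (a + a)%R == _] => leT.
    have cS : (#|A| <= #|T| + #|[set p in graph A | bad p (u, f u)]|)%N.
      rewrite -(cardsID T A) leq_add ?subset_leq_card ?subsetIr //.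
      rewrite -(card_graph (A :\: T)) subset_leq_card //.
      apply/subsetP => _ /imsetP[a + ->]; rewrite !inE => /andP[aT aA].
      have [aX _] := andP aA.
      by rewrite imset_f ?inE //= bad_graph // simA ?inE //; move: uU; rewrite !inE.
    have cA : (#|A| <= #|G|)%N := max_card _.
    (* At least 87/100 - 1/2 of [#|G|] remains bad, well above [#|A| / 100]. *)
    have ar (a b c d : nat) : (2 * c <= b -> 87 * b <= 100 * a -> a <= b ->
      a <= c + d -> a <= 100 * d)%N by clear; lia.
    exact: ar leT leA cA cS.
  - exact/graph_respected/subsetDl.
move=> u uX; apply/eqP; apply: contraT => fu.
have uU : u \in X :\: A by rewrite !inE uX (negPf fu).
have := spread (ne_psi u uU); apply: contraTT => _; rewrite -ltnNge.
apply: (@leq_ltn_trans (#|~: X| + #|X :\: A|)); last by rewrite ltn_add2l.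
apply: leq_trans (leq_card_setU _ _); apply/subset_leq_card/subsetP => a.
rewrite !inE; apply: contraTT; rewrite negb_or negbK => /andP[aX].
rewrite aX andbT negbK => /eqP fa.
apply/nandP; have [->|au] /= := eqVneq a u; first by left.
right; have iso : cayley Lambda a u = cayley Lambda a (psi (f u)).
  rewrite fiso // fa -{1}(psiK (f u)) /cayley (inj_eq (can_inj phiK)).
  by congr andb; rewrite (sim_mem (phi_sim a _)).
by rewrite iso addbb.
Qed.

Lemma partial_iso_rotation_reflection : exists phi : G -> G,
  (rotation phi \/ reflection phi) /\ {in X, f =1 phi}.
Proof.
have leX1 : (200 * s <= #|X|)%N.
  by move: leX s_le_cube; move: #|X| (s ^ 3)%N => a b; clear; lia.
have leX2 : (3200 * s ^ 3 <= #|X|)%N by apply: leq_trans (leq_pmull _ _) leX.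
(* Rigidity of the graph of [f] against itself yields a base vertex with few bad partners. *)
have [v0 v0X lebad] : exists2 v0, v0 \in X &
    (100 * #|[set p in graph X | bad p (v0, f v0)]| < #|X|)%N.
  apply/exists_inP; apply: contraT; rewrite negb_exists_in => /forall_inP dens.
  have [] := @rigid_dense s Lambda (graph X) (graph X) rig (graph_inj (subxx _))
    (graph_inj (subxx _)) s0; rewrite ?card_graph //.
    by move=> _ /imsetP[x /dens + ->]; rewrite -leqNgt.
  exact: graph_respected.
(* Agreement with the rotation ([A]) and the reflection ([B]) that send [v0] to [f v0]; every vertex
   of [X] outside both is bad with [v0]. *)
pose A := [set w in X | f w == w + (f v0 - v0)].
pose B := [set w in X | f w == - w + (f v0 + v0)].
have sAX : A \subset X by apply/subsetP => x; rewrite inE => /andP[].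
have sBX : B \subset X by apply/subsetP => x; rewrite inE => /andP[].
have cAB : (#|X :\: (A :|: B)| <=
    #|[set p in graph X | bad p (v0, f v0)]|)%N.
  rewrite -card_graph; apply/subset_leq_card/subsetP => _ /imsetP[w + ->].
  rewrite !inE => /andP[+ wX]; rewrite wX /= => nAB.
  rewrite imset_f //= bad_graph //; apply: contra nAB.
  rewrite /sim => /orP[/eqP|/eqP] e; apply/orP.
    by left; apply/eqP; rewrite addrCA e addrC subrK.
  right; apply/eqP/(addIr (- f v0)); rewrite -[LHS]opprK -e opprB.
  by rewrite -addrA (addrC (f v0)) addrK addrC.
(* If [f a - f b = a - b], then [b] would lie in [A]; if it is [b - a], then [a] would lie in
   [B]. *)
have CD_bad a b : a \in A :\: B -> b \in B :\: A -> bad (a, f a) (b, f b).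
  rewrite !inE => /andP[+ /andP[aX /eqP fa]] /andP[+ /andP[bX /eqP fb]].
  rewrite aX bX /= => naB nbA; rewrite bad_graph //.
  apply/negP; rewrite /sim => /orP[/eqP e|/eqP e].
    case/negP: nbA; apply/eqP/oppr_inj/(addrI (f a)).
    by rewrite -e fa opprD addrACA subrr addr0.
  case/negP: naB; apply/eqP/(addIr (- f b)).
  rewrite -[LHS]opprK -e opprB fb opprD opprK.
  by rewrite addrACA subrr addr0 addrC.
(* Every pair between [A :\: B] and [B :\: A] is bad, so one side is small. *)
have small : (#|A :\: B| < 200 * s)%N \/ (#|B :\: A| < 3200 * s ^ 3)%N.
  apply/orP; rewrite ltnNge (ltnNge #|_|) -negb_and; apply/negP => /andP[leC leD].
  have sC := subset_trans (subsetDl A B) sAX.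
  have sD := subset_trans (subsetDl B A) sBX.
  apply: (@rigid_dense s Lambda (graph (A :\: B)) (graph (B :\: A)));
    rewrite ?card_graph //; try exact: graph_inj; last exact: graph_respected.
  move=> _ /imsetP[b bD ->]; set S := [set p in _ | _].
  have -> : S = graph (A :\: B).
    apply/setP => p; rewrite inE; apply: andb_idr => /imsetP[a aC ->].
    exact: CD_bad.
  by rewrite card_graph leq_pmull.
have cX : (#|X| <= #|A :&: B| + #|A :\: B| + #|B :\: A| + #|X :\: (A :|: B)|)%N.
  rewrite cardsID -(cardsID (A :|: B) X) leq_add2r.
  have -> : X :&: (A :|: B) = A :|: (B :\: A).
    rewrite (setIidPr _) ?subUset ?sAX //; apply/setP => z.
    by rewrite !in_setU in_setD; case: (z \in A).
  exact: leq_card_setU.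
(* The losses are at most 1/100 and 1/10 of [#|X|], and 89/100 of 199/200 exceeds 87/100. *)
have main a d : (#|X| <= a + d + #|X :\: (A :|: B)|)%N ->
    (d <= 3200 * s ^ 3)%N -> (87 * #|G| <= 100 * a)%N.
  move: leX leGX (leq_ltn_trans (leq_mul (leqnn 100) cAB) lebad).
  by move: #|_| #|_| #|_| (s ^ 3)%N => b c e h; clear; lia.
have [smallC|smallD] := small.
  exists (fun x => - x + (f v0 + v0)); split; first by right; eexists.
  apply: (@agree_everywhere _ (fun y => - (y - (f v0 + v0)))).
  - by move=> x /=; rewrite addrK opprK.
  - by move=> x /=; rewrite opprK subrK.
  - by move=> x y; rewrite opprD addrACA subrr addr0 -opprD /sim opprK eqxx orbT.
  - apply: (main #|B| #|A :\: B|).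
      by rewrite -(cardsID A B) setIC [(#|A :&: B| + _ + _)%N]addnAC.
    rewrite (leq_trans (ltnW smallC)) //.
    by move: s_le_cube; move: (s ^ 3)%N => t; clear; lia.
exists (fun x => x + (f v0 - v0)); split; first by left; eexists.
apply: (@agree_everywhere _ (fun y => y - (f v0 - v0))).
- by move=> x /=; rewrite addrK.
- by move=> x /=; rewrite subrK.
- by move=> x y; rewrite opprD addrACA subrr addr0 /sim eqxx.
- by apply: (main #|A| #|B :\: A|) (ltnW smallD); rewrite -(cardsID B A).
Qed.

End PartialIsomorphism.
End FixedLambda.
End Rigidity.

(** * Expectation over random sets of inverse pairs *)

Section Expectation.
Variables (R : realFieldType) (p : R).

(** The index set [I] is arbitrary so that inductions can remove its elements one at a time. *)
Definition expect (K : finType) (I : {set K}) (F : {set K} -> R) : R :=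
  \sum_(S in powerset I) F S * \prod_(A in I) (if A \in S then p else 1 - p).

Variable K : finType.
Implicit Types (I S : {set K}) (A : K) (F : {set K} -> R).

Lemma eq_expect I F1 F2 : (forall S, S \subset I -> F1 S = F2 S) ->
  expect I F1 = expect I F2.
Proof.
by move=> eqF; apply: eq_bigr => S; rewrite powersetE => /eqF ->.
Qed.

Lemma expectZ I c F : expect I (fun S => c * F S) = c * expect I F.
Proof. by rewrite /expect big_distrr /=; apply: eq_bigr => S _; rewrite mulrA. Qed.

Lemma expectD I F1 F2 :
  expect I (fun S => F1 S + F2 S) = expect I F1 + expect I F2.
Proof. by rewrite /expect -big_split; apply: eq_bigr => S _; rewrite mulrDl. Qed.

Lemma expect_sum (J : finType) (P : pred J) I (F : J -> {set K} -> R) :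
  expect I (fun S => \sum_(j | P j) F j S) = \sum_(j | P j) expect I (F j).
Proof.
by rewrite /expect exchange_big; apply: eq_bigr => S _; rewrite big_distrl.
Qed.

Lemma le_expect I F1 F2 : 0 <= p <= 1 ->
  (forall S, S \subset I -> F1 S <= F2 S) -> expect I F1 <= expect I F2.
Proof.
move=> /andP[p0 p1] leF; apply: ler_sum => S; rewrite powersetE => /leF le12.
apply: ler_wpM2r le12; apply: prodr_ge0 => A _.
by case: ifP => _; rewrite ?subr_ge0.
Qed.

(** Conditioning on whether [A] is chosen. *)
Lemma expect_split I A F : A \in I ->
  expect I F = p * expect (I :\ A) (fun S => F (A |: S)) +
               (1 - p) * expect (I :\ A) F.
Proof.
move=> AI; rewrite /expect (bigID (fun S => A \in S)) /= !big_distrr /=.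
congr (_ + _).
  rewrite (reindex_onto (fun S => A |: S) (fun S => S :\ A)) /=; last first.
    by move=> S /andP[_ AS]; rewrite setD1K.
  apply: eq_big => [S|S].
    rewrite !powersetE subUset sub1set AI setU11 andbT /= subsetD1.
    rewrite andbC; case: (boolP (A \in S)) => AS; rewrite ?andbF ?andbT.
      apply/andP => -[/eqP e _]; move: AS.
      by rewrite -e !inE eqxx.
    by rewrite setU1K // eqxx.
  move=> /andP[_ /eqP e]; rewrite (big_setD1 A) //= setU11 mulrCA; congr (_ * (_ * _)).
  by apply: eq_bigr => B; rewrite !inE => /andP[/negPf -> _].
apply: eq_big => [S|S]; first by rewrite !powersetE subsetD1.
move=> /andP[_ AS]; rewrite (big_setD1 A) //= (negPf AS) mulrCA; congr (_ * (_ * _)).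
Qed.

Lemma expect1 I : expect I (fun=> 1) = 1.
Proof.
elim: {I}#|I| {-2}I (erefl #|I|) => [|n IHn] I.
  move/eqP; rewrite cards_eq0 => /eqP->; rewrite /expect powerset0 big_set1.
  by rewrite big_set0 mulr1.
move=> cI; have /card_gt0P[A AI] : (0 < #|I|)%N by rewrite cI.
rewrite (expect_split _ AI) IHn; first by rewrite -mulrDl addrC subrK mulr1.
by move: cI; rewrite (cardsD1 A) AI => -[].
Qed.

(** Multiplied over constraints, this is [theta] to the number of violations: an exponential moment
    for [theta = 3/4], the indicator of no violation for [theta = 0]. *)
Definition agree (theta : R) (a b : bool) : R := if a == b then 1 else theta.

(** The factors depend on disjoint coordinates. Two distinct coordinates differ with probability
    [2 * p * (1 - p)]. *)
Lemma expect_agree (E : eqType) (src dst : E -> K) (theta : R) (l : seq E) I :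
  uniq l ->
  {in l, forall e, [/\ src e \in I, dst e \in I & src e != dst e]} ->
  {in l &, forall e e', e != e' ->
    [&& src e != src e', src e != dst e', dst e != src e' & dst e != dst e']} ->
  expect I (fun S => \prod_(e <- l) agree theta (src e \in S) (dst e \in S)) =
  (1 - (1 - theta) * (2 * p * (1 - p))) ^+ size l.
Proof.
elim: l I => [|e l IHl] I /=.
  by move=> _ _ _; under eq_expect do rewrite big_nil; rewrite expect1 expr0.
move=> /andP[el ul] inI disj.
have [sI dI sd] : [/\ src e \in I, dst e \in I & src e != dst e].
  by apply: inI; rewrite mem_head.
set c := 1 - _; have {IHl}IH := IHl (I :\ src e :\ dst e) ul.
have IH2 : expect (I :\ src e :\ dst e) (fun S => \prod_(e' <- l)
    agree theta (src e' \in S) (dst e' \in S)) = c ^+ size l.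
  apply: IH => [e' e'l|e1 e2 e1l e2l].
    have e'l' : e' \in e :: l by rewrite inE e'l orbT.
    have ee' : e != e' by apply: contraNneq el => ->.
    have [] := inI _ e'l'; have /and4P[] := disj _ _ (mem_head _ _) e'l' ee'.
    move=> h1 h2 h3 h4 h5 h6 h7.
    by rewrite !inE h5 h6 !(eq_sym _ (src e)) !(eq_sym _ (dst e)) h1 h2 h3 h4.
  by apply: disj; rewrite inE ?e1l ?e2l orbT.
have dI' : dst e \in I :\ src e by rewrite !inE eq_sym sd.
rewrite (expect_split _ sI) !(expect_split _ dI') exprS -IH2.
(* [T] fixes the two coordinates of [e] and leaves the others alone, so the factor of [e] becomes
   constant. *)
have val (T : {set K} -> {set K}) x y : (forall S, S \subset I :\ src e :\ dst e ->
    [/\ src e \in T S = x, dst e \in T S = y &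
     forall A, A != src e -> A != dst e -> (A \in T S) = (A \in S)]) ->
  expect (I :\ src e :\ dst e) (fun S => \prod_(e' <- e :: l)
    agree theta (src e' \in T S) (dst e' \in T S)) =
  agree theta x y * expect (I :\ src e :\ dst e) (fun S => \prod_(e' <- l)
    agree theta (src e' \in S) (dst e' \in S)).
  move=> TP; rewrite -expectZ; apply: eq_expect => S /TP[sT dT oT].
  rewrite big_cons sT dT; congr (_ * _); apply: eq_big_seq => e' e'l.
  have e'l' : e' \in e :: l by rewrite inE e'l orbT.
  have ee' : e != e' by apply: contraNneq el => ->.
  have /and4P[h1 h2 h3 h4] := disj _ _ (mem_head _ _) e'l' ee'.
  by rewrite !oT // eq_sym.
have sub S : S \subset I :\ src e :\ dst e ->
    (src e \in S = false) /\ (dst e \in S = false).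
  move=> /subsetP sS; split; apply/negP => /sS; rewrite !inE eqxx //=.
  by rewrite andbF.
rewrite (val (fun S => src e |: (dst e |: S)) true true); last first.
  move=> S _; rewrite !inE !eqxx orbT; split=> // A /negPf h1 /negPf h2.
  by rewrite !inE h1 h2.
rewrite (val (fun S => src e |: S) true false); last first.
  move=> S /sub[sS dS]; rewrite !inE !eqxx (eq_sym (dst e)) (negPf sd) dS.
  by split=> // A /negPf h1 /negPf h2; rewrite !inE h1.
rewrite (val (fun S => dst e |: S) false true); last first.
  move=> S /sub[sS dS]; rewrite !inE !eqxx (negPf sd) sS.
  by split=> // A /negPf h1 /negPf h2; rewrite !inE h2.
rewrite (val id false false); last by move=> S /sub[sS dS].
by rewrite /c /agree /=; set X := expect _ _; ring.
Qed.

End Expectation.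

(** * From inverse pairs to connection sets *)

Lemma mem_cover_inverse_pairs (G : finZmodType) (S : {set {set G}}) (g : G) :
  S \subset inverse_pairs G ->
  (g \in cover S) = ([set g; - g] \in S).
Proof.
move=> /subsetP sS; apply/bigcupP/idP => [[A AS gA]|gS]; last first.
  by exists [set g; - g] => //; rewrite !inE eqxx.
have /imsetP[h _ defA] := sS _ AS.
suff <- : A = [set g; - g] by [].
by move: gA; rewrite defA !inE => /orP[/eqP->|/eqP->]; rewrite ?opprK // finset.setUC.
Qed.

Lemma inverse_pair_eq (G : finZmodType) (g h : G) :
  ([set g; - g] == [set h; - h]) = sim g h.
Proof.
apply/eqP/idP => [/setP/(_ g)|/orP[/eqP->//|/eqP->]].
  by rewrite !inE eqxx /= => /esym.
by rewrite opprK setUC.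
Qed.

Lemma expect_matching (R : realFieldType) (p theta : R) (G : finZmodType)
    (M : {set (G * G) * (G * G)}) :
  matching M ->
  expect p (inverse_pairs G) (fun S => \prod_(e in M)
    agree theta (lsrc e \in cover S) (ldst e \in cover S)) =
  (1 - (1 - theta) * (2 * p * (1 - p))) ^+ #|M|.
Proof.
move=> [Mbad Mdisj]; rewrite cardE.
pose cl (g : G) := [set g; - g].
rewrite -(@expect_agree R p _ _ (cl \o @lsrc G) (cl \o @ldst G) _ _
  (inverse_pairs G)) ?enum_uniq //.
- apply: eq_expect => S sS; rewrite big_enum /=; apply: eq_bigr => e eM.
  by rewrite !mem_cover_inverse_pairs.
- move=> e; rewrite mem_enum => /Mbad/and3P[b1 b2 b3].
  split; rewrite /= /cl ?inverse_pair_eq //;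
    by apply: (@imset_f _ _ (fun g => [set g; - g])); rewrite !inE subr_eq0.
- move=> e e'; rewrite !mem_enum => eM e'M /(Mdisj _ _ eM e'M).
  by rewrite /conflict !negb_or /= /cl !inverse_pair_eq /sim !negb_or.
Qed.

Lemma prod_agree (R : realFieldType) (theta : R) (G : finZmodType)
    (M : {set (G * G) * (G * G)}) (Lambda : {set G}) :
  \prod_(e in M) agree theta (lsrc e \in Lambda) (ldst e \in Lambda) =
  theta ^+ #|[set e in M | ~~ respects Lambda e]|.
Proof.
rewrite -prodr_const [RHS](eq_bigl
  (fun e => (e \in M) && ~~ respects Lambda e)); last by move=> e; rewrite inE.
rewrite big_mkcondr /=; apply: eq_bigr => e _.
by rewrite /agree /respects; case: eqP.
Qed.

Lemma cover_opp (G : finZmodType) (S : {set {set G}}) (g : G) :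
  S \subset inverse_pairs G -> (- g \in cover S) = (g \in cover S).
Proof.
by move=> sS; rewrite !mem_cover_inverse_pairs // opprK setUC.
Qed.

Lemma card_subsets_le (T : finType) (s : nat) :
  (#|[set S : {set T} | #|S| == s]| <= #|T| ^ s)%N.
Proof.
rewrite card_draws; apply: (@leq_trans ('C(#|T|, s) * s`!)).
  by rewrite leq_pmulr // fact_gt0.
rewrite bin_ffact; elim: s => [|s IHs]; first by rewrite ffactn0.
by rewrite ffactnSr expnSr leq_mul // leq_subr.
Qed.

From mathcomp Require Import all_classical all_reals all_analysis.
Import numFieldNormedType.Exports.
Local Open Scope ring_scope.

(** * Choice of parameters *)

Section ScaleChoice.
Variable R : realType.

Lemma ln_le_id (x : R) : 0 < x -> ln x <= x.
Proof.
move=> x0; rewrite -ler_expR lnK ?posrE //.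
by apply: le_trans (expR_ge1Dx x); rewrite lerDr.
Qed.

Lemma scale_choice (x : R) : 1 <= x ->
  exists s : nat, [/\ (0 < s)%N, s%:R <= x & x <= 2 * s%:R].
Proof.
move=> x1; have /andP[ls us] := truncn_itv (le_trans ler01 x1).
have s0 : (0 < Num.truncn x)%N by rewrite truncn_gt0.
exists (Num.truncn x); split=> //; apply: le_trans (ltW us) _.
rewrite -natr1; have : 1 <= (Num.truncn x)%:R :> R by rewrite ler1n.
lra.
Qed.

(* With [x = n ^ (1/40)] all the bounds become polynomial: [s] is about [x ^ 10],
   [p' >= x ^ (-8)] and [ln n <= 40 x]. *)
Lemma parameters : exists K0 : nat, (1 < K0)%N /\
  forall (n : nat) (p' : R), (K0 <= n)%N ->
  10 ^+ 3 * Num.sqrt (ln n%:R) * n%:R `^ (- (1 / 5)) <= p' ->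
  exists s : nat, [/\ (0 < s)%N,
    100 * (3200 * s%:R ^+ 3) <= n%:R `^ (4 / 5) :> R,
    n%:R `^ (4 / 5) <= p' * n%:R :> R,
    3000 * ln n%:R <= p' * n%:R :> R &
    5 * (3200 * ln n%:R) <= p' * s%:R :> R].
Proof.
(* The largest constant to absorb is 2 * 5 * 3200 * 40, in the last bound. *)
have [B defB] : exists B : R, B = 1000 * (1000 * 2) by eexists.
have B1 : 1 <= B by rewrite defB; lra.
have [K0 leK0] : exists K0 : nat, B ^+ 40 <= K0%:R.
  by exists (Num.truncn (B ^+ 40)).+1; rewrite ltW // truncnS_gt.
exists K0.+2; split=> // n p' leK.
have leKn : B ^+ 40 <= n%:R.
  by apply: le_trans leK0 _; rewrite ler_nat ltnW // ltnW.
have n0 : 0 < n%:R :> R by rewrite ltr0n; apply: leq_trans leK.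
have [x [x0 xn]] : exists x : R, 0 < x /\ x ^+ 40 = n%:R.
  exists (n%:R `^ (1 / 40)); rewrite powR_gt0 // -powR_mulrn ?powR_ge0 //.
  by rewrite -powRrM mul1r mulVf ?powRr1 // ltW.
have xB : B <= x.
  rewrite -(@ler_pXn2r _ 40) ?nnegrE ?xn // ltW //.
  exact: lt_le_trans ltr01 B1.
have x1 := le_trans B1 xB.
have lnx : ln n%:R = 40 * ln x :> R by rewrite -xn lnXn // mulr_natl.
(* From [ln x^-1 <= x^-1 - 1 <= - 1/2]; this lets the square root in the hypothesis be bounded below
   by 1. *)
have ln1 : 1 <= ln n%:R :> R.
  have : ln x^-1 <= x^-1 - 1.
    have := @le_ln1Dx R (x^-1 - 1); rewrite [1 + _]addrC subrK; apply.
    by rewrite ltrBrDl subrr invr_gt0.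
  rewrite lnV ?posrE // lnx => h.
  have : x^-1 <= 2^-1 by rewrite lef_pV2 ?posrE //; lra.
  lra.
have lnle : ln n%:R <= 40 * x :> R by rewrite lnx ler_pM2l // ln_le_id.
have n45 : n%:R `^ (4 / 5) = x ^+ 32.
  rewrite -xn -powR_mulrn ?ltW // -powRrM -powR_mulrn ?ltW //.
  by congr (_ `^ _); lra.
have n15 : n%:R `^ (- (1 / 5)) = (x ^+ 8)^-1.
  rewrite powRN; congr (_^-1).
  rewrite -xn -powR_mulrn ?ltW // -powRrM -powR_mulrn ?ltW //.
  by congr (_ `^ _); lra.
rewrite n15 n45 => lep'.
have [s [s0 sle les]] := scale_choice (exprn_ege1 10 x1).
have x8 : 0 < x ^+ 8 by rewrite exprn_gt0.
have p'x : 1 <= p' * x ^+ 8.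
  rewrite -ler_pdivrMr //; apply: le_trans lep'.
  rewrite ler_wpM2r ?invr_ge0 ?(ltW x8) //.
  have : 1 <= Num.sqrt (ln n%:R) :> R by rewrite -[leLHS]sqrtr1 ler_wsqrtr.
  have : (1 : R) <= 10 ^+ 3 by rewrite exprn_ege1 // ler1n.
  by move: (10 ^+ 3) (Num.sqrt _) => a b ha hb; nra.
have p'0 : 0 < p' by rewrite -(pmulr_lgt0 _ x8) (lt_le_trans _ p'x).
have x2 : B * x <= x ^+ 2 by rewrite expr2 ler_pM2r.
have le32 : x ^+ 32 <= p' * n%:R.
  by rewrite -xn (exprD x 8 32) mulrA ler_peMl // exprn_ge0 // ltW.
exists s; split=> //.
- have c3 : s%:R ^+ 3 <= x ^+ 30.
    by rewrite (exprM x 10 3) lerXn2r // ?nnegrE ?ler0n ?exprn_ge0 // ltW.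
  have : B * x ^+ 30 <= x ^+ 32.
    rewrite (exprD x 2 30) ler_wpM2r ?exprn_ge0 ?(ltW x0) //.
    by apply: le_trans x2; rewrite ler_peMr // (le_trans _ B1).
  have := ltW (exprn_gt0 30 x0).
  by move: c3; move: (s%:R ^+ 3) (x ^+ 30) (x ^+ 32) => t u v; rewrite defB; lra.
- apply: le_trans le32; apply: (@le_trans _ _ (x ^+ 2)).
    by move: x2 lnle; rewrite defB; move: (x ^+ 2) (ln _) => y l; lra.
  by rewrite ler_weXn2l.
- have h : x ^+ 2 <= p' * x ^+ 10.
    by rewrite (exprD x 8 2) mulrA ler_peMl // exprn_ge0 // ltW.
  have h2 : p' * x ^+ 10 <= 2 * (p' * s%:R) by rewrite [leRHS]mulrCA ler_pM2l.
  move: h h2 x2 lnle; rewrite defB.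
  by move: (x ^+ 2) (ln _) (p' * x ^+ 10) (p' * s%:R) => y l a b; lra.
Qed.
End ScaleChoice.

(** * Probability of typicality *)

Section Typicality.
Variables (R : realType) (G : finZmodType).
Let k : R := #|G|%:R.

Definition well_spread (r : R) (Lambda : {set G}) :=
  forall v w : G, v != w -> r <= #|distinguishers (cayley Lambda) v w|%:R.

(** Halving [p' / 25] gives the degree bound. For the last clause, the complement of [X] and
    [3200 * s ^ 3] are each at most [p' * k / 100], which stays below [p' * k / 25]. *)
Lemma typical_of_rigid (Lambda : {set G}) (s : nat) (p' : R) :
  (1 < #|G|)%N -> 0 < p' -> p' <= 1 / 2 -> (0 < s)%N ->
  100 * (3200 * s%:R ^+ 3) <= k `^ (4 / 5) -> k `^ (4 / 5) <= p' * k ->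
  (forall g, (- g \in Lambda) = (g \in Lambda)) ->
  rigid s Lambda -> well_spread (p' / 25 * k) Lambda ->
  typical (p' / 50) (p' / 100) (cayley Lambda).
Proof.
move=> G1 p'0 p'2 s0 sk kp symL rig spread.
have k0 : 0 < k by rewrite ltr0n ltnW.
pose t : R := (3200 * s ^ 3)%N%:R.
have t0 : 0 <= t by rewrite ler0n.
have tE : t = 3200 * s%:R ^+ 3 by rewrite /t natrM natrX.
rewrite -tE in sk.
have tp : 100 * t <= p' * k by apply: le_trans kp.
have s_t : (3 + 200 * s <= 3200 * s ^ 3)%N.
  apply: (@leq_trans (203 * s ^ 3)); last by rewrite leq_mul2r orbT.
  apply: (@leq_trans (203 * s)); first by move: s0; clear; lia.
  by rewrite leq_mul2l -{1}[s]expn1 leq_pexp2l ?orbT.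
split.
- move=> v; have [w vw] : exists w, v != w.
    have /card_gt1P[a [b [_ _ ab]]] : (1 < #|[set: G]|)%N by rewrite cardsT.
    by case: (eqVneq v a) ab => [->|va _]; [exists b|exists a].
  have := spread v w vw.
  have := distinguishers_neighbours symL v w.
  have := distinguishers_nonneighbours symL v w.
  rewrite -!(ler_nat R) !natrM natrB ?max_card // -/k.
  move: (#|_|%:R) (#|_|%:R) => a b ha hb hc; apply/andP; split; lra.
- by move=> v w /spread; apply: le_trans; rewrite ler_pM2r //; lra.
- move=> [X [Y [dXY leX leY homog]]].
  apply: (no_homogeneous_pair rig dXY s0 _ _ homog).
    apply: leq_trans s_t _; rewrite -(ler_nat R) -/t; lra.
  by rewrite -(ler_nat R) -/t; lra.
move=> X f leX finj fiso.
have cX : #|X|%:R + #|~: X|%:R = k by rewrite -natrD cardsC.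
apply: (partial_iso_rotation_reflection symL rig s0) => //.
- rewrite -(ler_nat R) !natrM -/k; nra.
- rewrite -(ler_nat R) natrM -/t; nra.
- move=> v w vw; rewrite -(ler_nat R) natrD -/t.
  apply: le_trans (spread _ _ vw); lra.
Qed.

End Typicality.

(** * First moment bound *)

Section Probability.
Variables (R : realType) (G : finZmodType).
Let k : R := #|G|%:R.

Lemma connection_set_probE (p : R) (P : {set G} -> Prop) :
  connection_set_prob p P =
  expect p (inverse_pairs G) (fun S => (`[< P (finset.cover S) >] : bool)%:R).
Proof.
rewrite /connection_set_prob /expect big_mkcondr /=; apply: eq_bigr => S _.
by case: asboolP => _; rewrite ?mul1r ?mul0r.
Qed.

(** The larger of [p], [1 - p] is at least 1/2, so [2 * p * (1 - p)] is at least the minimum; then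
    [1 - x <= expR (- x)]. *)
Lemma agree_factor_le (p theta : R) (m : nat) : 0 < p < 1 -> 0 <= theta <= 1 ->
  (1 - (1 - theta) * (2 * p * (1 - p))) ^+ m <=
  expR (- ((1 - theta) * Num.min p (1 - p) * m%:R)).
Proof.
move=> /andP[p0 p1] /andP[t0 t1].
have pq : Num.min p (1 - p) <= 2 * p * (1 - p) <= 1.
  apply/andP; split; last by nra.
  case: (leP p (1 - p)) => h.
    have := mulr_ge0 (ltW p0) (_ : 0 <= 1 - p - p); rewrite subr_ge0 => /(_ h); lra.
  have := mulr_ge0 (_ : 0 <= 1 - p) (_ : 0 <= p - (1 - p)).
  by rewrite !subr_ge0 => /(_ (ltW p1) (ltW h)); lra.
rewrite -[X in expR X]mulNr expRM_natr.
have /andP[pq1 pq2] := pq.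
rewrite lerXn2r // ?nnegrE ?expR_ge0 //.
  rewrite subr_ge0; apply: (@le_trans _ _ (1 * 1)); last by rewrite mul1r.
  by apply: ler_pM; nra.
apply: le_trans (expR_ge1Dx _); rewrite lerD2l lerN2 ler_wpM2l //; lra.
Qed.

(** Exponential Markov weight: [expR (1 / 3) >= 4 / 3]. *)
Lemma weight_ge1 (r : R) (n : nat) :
  n%:R <= r -> 1 <= expR (r / 3) * (3 / 4) ^+ n.
Proof.
move=> nr; apply: (@le_trans _ _ (expR (1 / 3) ^+ n * (3 / 4) ^+ n)).
  rewrite -exprMn exprn_ege1 //.
  by have := expR_ge1Dx (1 / 3 : R); lra.
rewrite -expRM_natr ler_wpM2r ?ler_expR ?exprn_ge0 //; lra.
Qed.

Lemma sum_le_card (I : finType) (P : pred I) (F : I -> R) (c : R) (n : nat) :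
  (forall i, P i -> F i <= c) -> 0 <= c -> (#|P| <= n)%N ->
  \sum_(i | P i) F i <= n%:R * c.
Proof.
move=> Fc c0 Pn; apply: le_trans (ler_sum _ Fc) _.
by rewrite sumr_const -[leLHS]mulr_natl ler_wpM2r // ler_nat.
Qed.

(* First moment bound: the failure of spreading at [v, w] forces a product of
   weights 3/4 to exceed [expR (- r / 3)], and the failure of rigidity forces
   some product of indicators of agreement to be 1. *)
Lemma prob_ge_rigid_spread (p r : R) (s : nat) (P : {set G} -> Prop) :
  0 < p < 1 -> (68 <= #|G|)%N ->
  (forall S : {set {set G}}, S \subset inverse_pairs G -> rigid s (finset.cover S) ->
    well_spread r (finset.cover S) -> P (finset.cover S)) ->
  1 - (k ^+ 2 * expR (r / 3 - Num.min p (1 - p) * k / 68) +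
       k ^+ (4 * s) * expR (- (Num.min p (1 - p) * s%:R ^+ 2 / 3200)))
  <= connection_set_prob p P.
Proof.
move=> p01 G68 PP; set p' := Num.min p (1 - p).
have p'0 : 0 <= p'.
  by rewrite /p'; have /andP[? ?] := p01; case: (leP p (1 - p)) => ?; lra.
have /fin_all_exists[MV MVP] : forall vw : G * G,
    exists M : {set (G * G) * (G * G)}, vw.1 != vw.2 -> [/\ matching M,
      (#|G| <= 16 * #|M| + 4)%N & forall Lambda,
      (#|[set e in M | ~~ respects Lambda e]| <=
      #|distinguishers (cayley Lambda) vw.1 vw.2|)%N].
  move=> vw; case: (eqVneq vw.1 vw.2) => [_|/distinguishing_matching[M MP]].
    by exists finset.set0.
  by exists M.
pose T := [set t : {set G * G} * {set G * G} |
  [&& #|t.1| == s, #|t.2| == s & `[< testing s t.1 t.2 >]]].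
have /fin_all_exists[MT MTP] : forall t : {set G * G} * {set G * G},
    exists M : {set (G * G) * (G * G)}, t \in T ->
    [/\ forall e, e \in M -> (e.1 \in t.1) && (e.2 \in t.2),
        matching M & (s ^ 2 <= 3200 * #|M|)%N].
  move=> t; case: (boolP (t \in T)) => [|_]; last by exists finset.set0.
  by rewrite inE => /and3P[_ _ /asboolP[M MP]]; exists M.
pose w theta (M : {set (G * G) * (G * G)}) (S : {set {set G}}) : R :=
  \prod_(e in M) agree theta (lsrc e \in finset.cover S) (ldst e \in finset.cover S).
have w0 theta M (S : {set {set G}}) : 0 <= theta -> 0 <= w theta M S.
  by move=> t0; rewrite /w prod_agree exprn_ge0.
have p01' : 0 <= p <= 1 by have /andP[/ltW-> /ltW->] := p01.
(* Union bound on each outcome: where [P] fails, some summand is at least 1. *)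
have pointwise (S : {set {set G}}) : S \subset inverse_pairs G ->
    1 <= (`[< P (finset.cover S) >] : bool)%:R +
         (\sum_(vw : G * G | vw.1 != vw.2) expR (r / 3) * w (3 / 4) (MV vw) S +
          \sum_(t in T) w 0 (MT t) S).
  move=> sS.
  have h1 : 0 <= \sum_(vw : G * G | vw.1 != vw.2) expR (r / 3) * w (3 / 4) (MV vw) S.
    by apply: sumr_ge0 => vw _; rewrite mulr_ge0 ?expR_ge0 ?w0 //; lra.
  have h2 : 0 <= \sum_(t in T) w 0 (MT t) S by apply: sumr_ge0 => t _; rewrite w0.
  have h3 : 0 <= (`[< P (finset.cover S) >] : bool)%:R :> R by rewrite ler0n.
  case: (pselect (rigid s (finset.cover S))) => [rig|nrig].
    case: (pselect (well_spread r (finset.cover S))) => [spr|nspr].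
      have /asboolP -> := PP S sS rig spr; rewrite lerDl addr_ge0 //.
    move/existsNP: nspr => [v /existsNP[u /not_implyP[vu /negP]]].
    rewrite -ltNge => ltr.
    have h4 : expR (r / 3) * w (3 / 4) (MV (v, u)) S <=
        \sum_(vw : G * G | vw.1 != vw.2) expR (r / 3) * w (3 / 4) (MV vw) S.
      rewrite (bigD1 (v, u)) //= lerDl sumr_ge0 // => vw _.
      by rewrite mulr_ge0 ?expR_ge0 ?w0 //; lra.
    have [_ _ /(_ (finset.cover S)) leD] := MVP (v, u) vu.
    suff : 1 <= expR (r / 3) * w (3 / 4) (MV (v, u)) S by lra.
    rewrite /w prod_agree; apply: weight_ge1; apply: le_trans (ltW ltr).
    by rewrite ler_nat.
  have [S1 [S2 [c1 c2 tst resp]]] : exists S1 S2 : {set G * G},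
      [/\ #|S1| = s, #|S2| = s, testing s S1 S2 &
          respected (finset.cover S) S1 S2].
    apply: contrapT => nex; apply: nrig => S1 S2 c1 c2 tst resp.
    by apply: nex; exists S1, S2.
  have tT : (S1, S2) \in T by rewrite inE /= c1 c2 eqxx; apply/asboolP.
  have [MS [mbad _] _] := MTP _ tT.
  have w1 : w 0 (MT (S1, S2)) S = 1.
    rewrite /w big1 // => e eM; rewrite /agree.
    have /andP[e1 e2] := MS e eM.
    by have := resp _ _ e1 e2 (mbad e eM); rewrite /respects -surjective_pairing => ->.
  rewrite (bigD1 _ tT) /= w1.
  have : 0 <= \sum_(t in T | t != (S1, S2)) w 0 (MT t) S.
    by apply: sumr_ge0 => t _; rewrite w0.
  lra.
have := @le_expect _ p _ (inverse_pairs G) _ _ p01' pointwise.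
rewrite expect1 !expectD -connection_set_probE !expect_sum => h.
rewrite lerBlDr; apply: le_trans h _; rewrite lerD2l lerD //.
- rewrite /k -natrX; apply: sum_le_card => [vw vwP||].
  + rewrite expectZ expect_matching; last by have [] := MVP vw vwP.
    rewrite expRD ler_wpM2l ?expR_ge0 //.
    apply: le_trans (agree_factor_le _ p01 _) _; first by lra.
    rewrite ler_expR lerN2.
    have [_ cM _] := MVP vw vwP.
    (* Order at least 68 absorbs the additive 4; the exponent is then [p' * k / (4 * 17)]. *)
    have : (#|G| <= 17 * #|MV vw|)%N by move: G68 cM; clear; lia.
    rewrite -(ler_nat R) natrM -/k -/p'; move: (#|_|%:R) => m h.
    by have := ler_wpM2l p'0 h; lra.
  + exact: expR_ge0.
  + by apply: leq_trans (max_card _) _; rewrite card_prod mulnn.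
- rewrite /k -natrX; apply: sum_le_card => [t tT||].
  + have [_ Mm cM] := MTP t tT; rewrite expect_matching //.
    apply: le_trans (agree_factor_le _ p01 _) _; first by lra.
    rewrite ler_expR lerN2.
    move: cM; rewrite -(ler_nat R) natrM natrX -/p'.
    move: (#|_|%:R) (s%:R ^+ 2) => m x h.
    by have := ler_wpM2l p'0 h; lra.
  + exact: expR_ge0.
  (* Two [s]-subsets of [G * G] give the exponent [4 * s]. *)
  + pose A := [set S : {set G * G} | #|S| == s].
    have sT : T \subset finset.setX A A.
      by apply/fintype.subsetP => t; rewrite !inE => /and3P[-> ->].
    apply: leq_trans (subset_leq_card sT) _; rewrite cardsX.
    apply: leq_trans (leq_mul (card_subsets_le _ _) (card_subsets_le _ _)) _.
    rewrite card_prod -expnD mulnn -expnM; apply/eq_leq; congr (_ ^ _)%N.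
    by clear; lia.
Qed.

End Probability.

Lemma expr_expR_le_inv (R : realType) (k y : R) (m : nat) :
  0 < k -> m.+1%:R * ln k <= y -> k ^+ m * expR (- y) <= k^-1.
Proof.
move=> k0 le_y; rewrite -[k]lnK ?posrE // -expRM_natl -expRN -expRD ler_expR.
by move: le_y; rewrite -natr1; lra.
Qed.

Lemma connection_set_prob_ge0 (R : realType) (G : finZmodType) (p : R)
    (P : {set G} -> Prop) : 0 < p < 1 -> 0 <= connection_set_prob p P.
Proof.
move=> /andP[p0 p1]; apply: sumr_ge0 => S _; apply: prodr_ge0 => A _.
by case: ifP => _; rewrite ?subr_ge0 ltW.
Qed.

Theorem theorem2p2 (R : realType) :
  exists eps : nat -> R,
    [/\ forall k, 0 <= eps k <= 1,
        (eps k @[k --> \oo] --> (0 : R))%classic &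
        forall (G : finZmodType) (p : R),
          let k : R := #|G|%:R in
          let p' := Num.min p (1 - p) in
          0 < p < 1 ->
          10 ^+ 3 * Num.sqrt (ln k) * k `^ (- (1 / 5)) <= p' ->
          1 - eps #|G| <=
            connection_set_prob p (fun Lambda : {set G} =>
              typical (p' / 50) (p' / 100) (cayley Lambda))].
Proof.
have [K0 [K01 params]] := parameters R.
pose K := maxn K0 68.
(* Each of the two error terms is at most [k^-1 <= 2 / (k + 1)], and [harmonic n] is
   [1 / (n + 1)]. *)
exists (fun n => if (n < K)%N then 1 else 4 * harmonic n); split.
- move=> n; case: ltnP => [_|Kn]; first by rewrite ler01 lexx.
  rewrite /harmonic; have n0 : 0 < n.+1%:R :> R by rewrite ltr0n.
  rewrite mulr_ge0 ?invr_ge0 ?(ltW n0) //= ler_pdivrMr // mul1r ler_nat.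
  by apply: leq_trans (leq_trans _ (leq_trans (leq_maxr K0 68) Kn)) _.
- have lim4 : (4 * harmonic n @[n --> \oo] --> (4 * 0 : R))%classic.
    by apply: cvgMr; exact: cvg_harmonic.
  rewrite mulr0 in lim4; apply: cvg_trans lim4.
  apply: near_eq_cvg; exists K => // n /= Kn.
  by rewrite ltnNge Kn.
move=> G p k p' p01 lep'.
case: ltnP => [_|Kn]; first by rewrite subrr connection_set_prob_ge0.
have K0n : (K0 <= #|G|)%N by apply: leq_trans (leq_maxl _ _) Kn.
have G68 : (68 <= #|G|)%N by apply: leq_trans (leq_maxr _ _) Kn.
have k0 : 0 < k by rewrite ltr0n; apply: leq_trans G68.
have [p0 p1] := andP p01.
have [p'0 le_p'2] : 0 < p' /\ p' <= 1 / 2.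
  by rewrite /p'; case: (leP p (1 - p)) => h; split; lra.
have [s [s0 sk kp lnk lns]] := params _ _ K0n lep'.
have main : forall S : {set {set G}}, S \subset inverse_pairs G ->
    rigid s (finset.cover S) ->
    well_spread (p' / 25 * k) (finset.cover S) ->
    typical (p' / 50) (p' / 100) (cayley (finset.cover S)).
  move=> S sS; apply: typical_of_rigid => //.
  - exact: leq_trans K0n.
  - by move=> g; exact: cover_opp.
apply: le_trans (prob_ge_rigid_spread p01 G68 main).
rewrite lerD2l lerN2 -/k -/p'.
(* The rate is 1/68 - 1/75 = 7/5100, and 3000 * 7/5100 exceeds 3. *)
have h1 : k ^+ 2 * expR (p' / 25 * k / 3 - p' * k / 68) <= k^-1.
  rewrite -[_ / 3 - _]opprK; apply: expr_expR_le_inv => //.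
  by have := mulr_gt0 p'0 k0; move: lnk; rewrite -/k; lra.
(* The exponent is at least [5 * s * ln k], and [5 * s >= 4 * s + 1]. *)
have h2 : k ^+ (4 * s) * expR (- (p' * s%:R ^+ 2 / 3200)) <= k^-1.
  apply: expr_expR_le_inv => //.
  have s1 : 1 <= s%:R :> R by rewrite ler1n.
  have ln0 : 0 <= ln k by rewrite ln_ge0 // ler1n; apply: leq_trans G68.
  have h := ler_wpM2l (le_trans ler01 s1) lns.
  have := ler_wpM2r ln0 s1; rewrite mul1r => h'.
  have -> : (4 * s).+1%:R = 4 * s%:R + 1 :> R by rewrite -natr1 natrM.
  by rewrite -/k in h; lra.
have h3 : k^-1 <= 2 * harmonic #|G|.
  rewrite /harmonic /= -natr1 -/k ler_pdivlMr ?ltr_wpDl ?(ltW k0) //.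
  rewrite mulrC ler_pdivrMr //.
  have : 1 <= k by rewrite ler1n; apply: leq_trans G68.
  lra.
lra.
Qed.
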